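(* Let $R$ be a (not-necessarily-commutative) ring, and let $A=(a_{ij})$ and $B=(b_{ij})$ be $m\times n$ matrices with elements in $R$. Suppose that for all $i,k\in[m]$ and $j,l\in[n]$ $$[a_{ij},b_{kl}] = -h_{ik}\delta_{jl},$$ where $(h_{ik})_{i,k=1}^m$ are elements of $R$. Then, for any $I,J\subseteq[m]$ of cardinality $|I|=|J|=r$ (with $1\le r\le m$; $r>n$ is allowed), writing $I=\{i_1<\dots<i_r\}$ and $J=\{j_1<\dots<j_r\}$: (a) If $A$ is row-pseudo-commutative, then $$\sum_{L\subseteq[n],\,|L|=r}\bigl(\text{col-det}\,A_{IL}\bigr)\bigl(\text{col-det}\,(B^{\mathrm T})_{LJ}\bigr)=\text{col-det}\bigl[(AB^{\mathrm T})_{IJ}+Q_{\rm col}\bigr],$$ where $(Q_{\rm col})_{\alpha\beta}=(r-\beta)\,h_{i_\alpha j_\beta}$ for $1\le\alpha,\beta\le r$. (b) If $B$ is row-pseudo-commutative, then $$\sum_{L\subseteq[n],\,|L|=r}\bigl(\text{row-det}\,A_{IL}\bigr)\bigl(\text{row-det}\,(B^{\mathrm T})_{LJ}\bigr)=\text{row-det}\bigl[(AB^{\mathrm T})_{IJ}+Q_{\rm row}\bigr],$$ where $(Q_{\rm row})_{\alpha\beta}=(\alpha-1)\,h_{i_\alpha j_\beta}$ for $1\le\alpha,\beta\le r$. In particular, (c) If $[a_{ij},a_{kl}]=0$ and $[b_{ij},b_{kl}]=0$ whenever $i\ne k$, then $$\sum_{L\subseteq[n],\,|L|=r}\bigl(\det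 A_{IL}\bigr)\bigl(\det\,(B^{\mathrm T})_{LJ}\bigr)=\text{col-det}\bigl[(AB^{\mathrm T})_{IJ}+Q_{\rm col}\bigr]=\text{row-det}\bigl[(AB^{\mathrm T})_{IJ}+Q_{\rm row}\bigr].$$
   Context: Notation: $[n]=\{1,\dots,n\}$; $[x,y]=xy-yx$; $M_{IJ}$ is the submatrix of $M$ with rows $I$ and columns $J$ kept in their original (increasing) order; empty sums are $0$. $h_{ik}\delta_{jl}$ means $h_{ik}$ if $j=l$ and $0$ otherwise (so $R$ need not have an identity). For an $r\times r$ matrix $M$ over a ring, $\text{col-det}\,M=\sum_{\sigma\in\mathcal S_r}\mathrm{sgn}(\sigma)\,M_{\sigma(1)1}M_{\sigma(2)2}\cdots M_{\sigma(r)r}$ and $\text{row-det}\,M=\sum_{\sigma\in\mathcal S_r}\mathrm{sgn}(\sigma)\,M_{1\sigma(1)}M_{2\sigma(2)}\cdots M_{r\sigma(r)}$. When entries not in the same row and not in the same column commute, the two coincide and are written $\det M$; this applies to the determinants written $\det$ in (c). A (not necessarily square) matrix $M$ is row-pseudo-commutative if $[M_{ij},M_{kl}]=[M_{kj},M_{il}]$ for all $i,j,k,l$ and $[M_{ij},M_{kj}]=0$ for all $i,j,k$. *)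

(* Defs.v *)
From HB Require Import structures.
From mathcomp Require Import all_boot all_order all_fingroup all_algebra.

Set Implicit Arguments.
Unset Strict Implicit.
Unset Printing Implicit Defensive.

Import GRing.Theory.
Local Open Scope ring_scope.

(* MathComp's ring structures all have a unit; a [rngType] is an associative
   ring, neither commutative nor unital. *)
HB.mixin Record Zmodule_isRng R & GRing.Zmodule R := {
  rmul : R -> R -> R;
  rmulA : associative rmul;
  rmulDl : left_distributive rmul +%R;
  rmulDr : right_distributive rmul +%R
}.

#[short(type="rngType")]
HB.structure Definition Rng := { R of Zmodule_isRng R & GRing.Zmodule R }.

Notation "x ** y" := (rmul x y) (at level 40, left associativity) : ring_scope.

Definition rcomm (R : rngType) (x y : R) : R := x ** y - y ** x.

(* Ordered product. Without a unit the empty product has no meaning; the value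
   0 given to it is arbitrary, and determinants of size 0 are not used. *)
Definition rprod (R : rngType) (s : seq R) : R :=
  if s is x :: s' then foldl rmul x s' else 0.

Definition rmulmx (R : rngType) (m n p : nat) (A : 'M[R]_(m, n))
    (B : 'M[R]_(n, p)) : 'M[R]_(m, p) :=
  \matrix_(i < m, k < p) \sum_(j < n) A i j ** B j k.

Definition col_det (R : rngType) (r : nat) (M : 'M[R]_r) : R :=
  \sum_(s : 'S_r) rprod [seq M (s a) a | a <- enum 'I_r] *~ (-1) ^+ s.

Definition row_det (R : rngType) (r : nat) (M : 'M[R]_r) : R :=
  \sum_(s : 'S_r) rprod [seq M a (s a) | a <- enum 'I_r] *~ (-1) ^+ s.

(* Only meaningful for matrices whose entries in distinct rows and distinct
   columns commute; see [rdet_row_det]. *)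
Definition rdet (R : rngType) (r : nat) (M : 'M[R]_r) : R := col_det M.

Definition ksubset (n r : nat) : finType := {I : {set 'I_n} | #|I| == r}.

(* [elt I a] is the element of I of rank a (from 0) in increasing order; see
   [elt_lt] and [elt_codom]. *)
Definition elt (n r : nat) (I : ksubset n r) (a : 'I_r) : 'I_n :=
  enum_val (cast_ord (esym (eqP (valP I))) a).

Definition minormx (R : Type) (m n r : nat) (M : 'M[R]_(m, n))
    (I : ksubset m r) (J : ksubset n r) : 'M[R]_r :=
  mxsub (elt I) (elt J) M.

Definition row_pseudo_commutative (R : rngType) (m n : nat)
    (M : 'M[R]_(m, n)) : Prop :=
  (forall (i k : 'I_m) (j l : 'I_n),
     rcomm (M i j) (M k l) = rcomm (M k j) (M i l)) /\
  (forall (i k : 'I_m) (j : 'I_n), rcomm (M i j) (M k j) = 0).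

(* Ranks a, b start at 0, so that beta = b.+1 and alpha - 1 = a. *)
Definition Q_col (R : rngType) (m r : nat) (h : 'M[R]_m)
    (I J : ksubset m r) : 'M[R]_r :=
  \matrix_(a < r, b < r) (h (elt I a) (elt J b) *+ (r - b.+1)).

Definition Q_row (R : rngType) (m r : nat) (h : 'M[R]_m)
    (I J : ksubset m r) : 'M[R]_r :=
  \matrix_(a < r, b < r) (h (elt I a) (elt J b) *+ a).

Lemma elt_lt (n r : nat) (I : ksubset n r) (a b : 'I_r) :
  (a < b)%N -> (elt I a < elt I b)%N.
Proof.
move=> ab; rewrite /elt; set a' := cast_ord _ a; set b' := cast_ord _ b.
have i0 : 'I_n := enum_val a'.
have srt : sorted ltn [seq val i | i <- enum (val I)].
  rewrite /enum_mem -enumT; apply: (subseq_sorted ltn_trans).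
    exact: (map_subseq _ (filter_subseq _ _)).
  by rewrite val_enum_ord; apply: iota_ltn_sorted.
have sz c : (cast_ord (esym (eqP (valP I))) c < size (enum (val I)))%N.
  by rewrite -cardE ltn_ord.
rewrite !(enum_val_nth i0) -!(nth_map i0 0%N val) ?sz //.
by apply: (sorted_ltn_nth ltn_trans) => //; rewrite inE size_map sz.
Qed.

Lemma elt_codom (n r : nat) (I : ksubset n r) : [set elt I a | a : 'I_r] = val I.
Proof.
apply/setP=> i; apply/imsetP/idP=> [[a _ ->]|iI]; first exact: enum_valP.
exists (cast_ord (eqP (valP I)) (enum_rank_in iI i)) => //.
by rewrite /elt cast_ordK enum_rankK_in.
Qed.

Lemma rprod_cons (R : rngType) (x : R) s : s != [::] -> rprod (x :: s) = x ** rprod s.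
Proof.
case: s => // y s _ /=.
by elim: s y x => //= z s IHs y x; rewrite -IHs /= rmulA.
Qed.

Lemma rprod_catC (R : rngType) (s t : seq R) x :
  {in s, forall y, x ** y = y ** x} -> rprod (s ++ x :: t) = rprod (x :: s ++ t).
Proof.
elim: s => // y s IHs xC.
have yx : x ** y = y ** x by apply: xC; rewrite mem_head.
rewrite [(y :: s) ++ _]cat_cons rprod_cons; last by case: (s).
rewrite IHs => [|z zs]; last by apply: xC; rewrite inE zs orbT.
by rewrite -rprod_cons //= yx.
Qed.

Lemma perm_rprod (R : rngType) (s t : seq R) :
  {in s &, forall x y, x ** y = y ** x} -> perm_eq s t -> rprod s = rprod t.
Proof.
elim: s t => [|x s IHs] t sC st; first by case: t st => // y t /perm_size.
have xt : x \in t by rewrite -(perm_mem st) mem_head.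
case/splitPr: xt st => t1 t2 st.
have st12 : perm_eq s (t1 ++ t2).
  by move: st; rewrite perm_sym perm_catC /= perm_cons perm_catC perm_sym.
rewrite rprod_catC => [|y yt]; last first.
  by apply: sC; rewrite ?mem_head // (perm_mem st) mem_cat yt.
have [s0|sN0] := eqVneq s [::].
  by move: st12; rewrite s0 => /perm_size /esym /size0nil ->.
have tN0 : t1 ++ t2 != [::] by rewrite -size_eq0 -(perm_size st12) size_eq0.
rewrite !rprod_cons // (IHs _ _ st12) // => y z ys zs.
by apply: sC; rewrite inE ?ys ?zs orbT.
Qed.

Lemma rdet_row_det (R : rngType) (r : nat) (M : 'M[R]_r) :
    (forall i j k l, i != k -> j != l -> rcomm (M i j) (M k l) = 0) ->
  rdet M = row_det M.
Proof.
move=> MC; rewrite /rdet /col_det (reindex_inj invg_inj) /=.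
apply: eq_bigr => s _; rewrite odd_permV; congr (_ *~ _).
apply: perm_rprod => [x y /mapP[a _ ->] /mapP[b _ ->]|].
  have [->//|ab] := eqVneq a b.
  by apply/eqP; rewrite -subr_eq0; apply/eqP/MC; rewrite ?(inj_eq perm_inj).
have sE : perm_eq (enum 'I_r) [seq s a | a <- enum 'I_r].
  apply: uniq_perm; rewrite ?enum_uniq ?(map_inj_uniq perm_inj) ?enum_uniq //.
  move=> a; rewrite mem_enum; apply/esym/mapP.
  by exists (s^-1%g a); rewrite ?mem_enum ?permKV.
apply: perm_trans (perm_map _ sE) _; rewrite -map_comp.
have E : (fun a => M (s^-1%g a) a) \o s =1 (fun a => M a (s a)).
  by move=> a /=; rewrite permK.
by rewrite (eq_map E).
Qed.

(* Main.v *)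
Require Import Defs.
From HB Require Import structures.
From mathcomp Require Import all_boot all_order all_fingroup all_algebra.

Set Implicit Arguments.
Unset Strict Implicit.
Unset Printing Implicit Defensive.

Import GRing.Theory.
Local Open Scope ring_scope.

(**
The identity is first proved over a unital ring, where ordered products are
ordinary iterated products; a ring without unit embeds in its unitization
Z x R, and the embedding carries determinants of positive size to
determinants.

Over a unital ring, write A_f for the matrix with columns f 0, f 1, ... of A,
where f is any map from ranks to columns. When A is row-pseudo-commutative its
column determinants are antisymmetric and alternating in the columns
([cdet_col_perm], [cdet_alternate]), as over a commutative ring. Hence the sum
over L of products of minors equals the sum over all f of
det A_f * B 0 (f 0) * B 1 (f 1) * ... ([sum_ksubset_cdet]): the
non-injective f contribute nothing, and an injective f is an increasing
enumeration of its image followed by a permutation.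

That sum is computed by induction on r ([sum_cdet_colsub]). Expand det A_f
along its first column and move B 0 (f 0) leftwards through the cofactors, so
that it lands next to A i (f 0). Summed over f 0, the leading term gives the
entries of the first column of A B^T. The commutator with the k-th column of
A_f vanishes unless f k = f 0, and then it replaces this column by minus the
first column of h, while the column it replaces stands in position 0.
Exchanging columns 0 and k puts h first with a plus sign and restores
the other columns; as k takes r - 1 values, the correction is (r - 1) h. The
exchange is legitimate because h behaves like one more column of A:
[A i j, h k s] is symmetric in i and k by the Jacobi identity
([lie_structure_sym]).

The row version is the column version over the converse ring: reversing
products turns row determinants into column determinants of the transpose with
its columns in reverse order, and exchanges the roles of A and B. In the
commuting case both versions apply and their left-hand sides agree.
*)

(** * Determinants over unital rings *)

Definition lie (S : pzRingType) (x y : S) : S := x * y - y * x.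

Notation "[< x , y >]" := (lie x y)
  (at level 0, format "[<  x ,  y  >]") : ring_scope.

Definition cdet (S : pzRingType) (r : nat) (M : 'M[S]_r) : S :=
  \sum_(s : 'S_r) (\prod_c M (s c) c) *~ (-1) ^+ s.

Definition rowdet (S : pzRingType) (r : nat) (M : 'M[S]_r) : S :=
  \sum_(s : 'S_r) (\prod_a M a (s a)) *~ (-1) ^+ s.

(** The exchange law needed to permute the columns of a column determinant; it
    is demanded of distinct columns only, so that a column whose entries do
    not commute among themselves may be adjoined. *)
Definition cross_symmetric (S : pzRingType) (m n : nat) (M : 'M[S]_(m, n)) :=
  forall i k c d, c != d -> [< M i c, M k d >] = [< M k c, M i d >].

Definition row_pseudo_comm (S : pzRingType) (m n : nat) (M : 'M[S]_(m, n)) :=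
  (forall i k j l, [< M i j, M k l >] = [< M k j, M i l >]) /\
  (forall i k j, [< M i j, M k j >] = 0).

(** Even and odd permutations cancel in pairs. The proof splits the sum by
    parity instead of showing that it equals its opposite, since V may have
    2-torsion. *)
Lemma sum_sign_sym (V : zmodType) (r : nat) (c d : 'I_r) (G : 'S_r -> V) :
    c != d -> (forall s, G (tperm c d * s)%g = G s) ->
  \sum_(s : 'S_r) G s *~ (-1) ^+ s = 0.
Proof.
move=> cd GE; rewrite (bigID (fun s : 'S_r => odd_perm s)) /=.
rewrite (reindex_inj (mulgI (tperm c d))) /=.
have oE (s : 'S_r) : odd_perm (tperm c d * s)%g = ~~ s.
  by rewrite odd_permM odd_tperm cd.
under eq_bigl do rewrite oE.
apply/eqP; rewrite addr_eq0 -sumrN; apply/eqP; apply: eq_bigr => s sN.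
by rewrite oE GE (negPf sN) /= expr0 expr1 mulrNz.
Qed.

Section Unital.
Variable S : pzRingType.
Implicit Types (r m n : nat).

Lemma eq_cdet r (M N : 'M[S]_r) : M =2 N -> cdet M = cdet N.
Proof. by move=> /matrixP ->. Qed.

(** The cofactor stands to the right of the entry, because in a column
    determinant the factor from column 0 comes first. *)
Lemma cdet_expand_col0 r (M : 'M[S]_r.+1) :
  cdet M = \sum_i (M i ord0 * cdet (row' i (col' ord0 M))) *~ (-1) ^+ i.
Proof.
pose f (p : 'I_r.+1 * 'S_r) := lift_perm ord0 p.1 p.2.
have f_inj : injective f.
  move=> [i s] [j t] /= E.
  have ij : i = j.
    by have := congr1 (fun u : {perm _} => u ord0) E; rewrite /f !lift_perm_id.
  rewrite ij in E *; congr (_, _); apply/permP => k; apply: (@lift_inj _ j).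
  have := congr1 (fun u : {perm _} => u (lift ord0 k)) E.
  by rewrite /f !lift_perm_lift.
have f_bij : bijective f.
  apply: inj_card_bij f_inj _.
  by rewrite card_prod card_ord !card_Sn factS.
rewrite /cdet (reindex f); last exact: onW_bij.
rewrite -(pair_big xpredT xpredT
  (fun i s => (\prod_c M (f (i, s) c) c) *~ (-1) ^+ (f (i, s)))) /=.
apply: eq_bigr => i _; rewrite mulr_sumr mulrz_suml.
apply: eq_bigr => s _; rewrite big_ord_recl /f /= lift_perm_id mulrzAr.
rewrite odd_lift_perm /= signr_addb signr_odd mulrC mulrzA.
congr (_ * _ *~ _ *~ _); apply: eq_bigr => c _.
by rewrite lift_perm_lift !mxE.
Qed.

(** * Column antisymmetry *)

Lemma prod_perm01 r (M : 'M[S]_r.+2) (s : 'S_r.+2) :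
  \prod_c M (s c) c = M (s ord0) ord0 * M (s (lift ord0 ord0)) (lift ord0 ord0)
    * \prod_c M (s (lift ord0 (lift ord0 c))) (lift ord0 (lift ord0 c)).
Proof. by rewrite !big_ord_recl mulrA. Qed.

Definition ord_one r : 'I_r.+2 := lift ord0 ord0.

Lemma tperm01_tail r (c : 'I_r) :
  tperm ord0 (ord_one r) (lift ord0 (lift ord0 c)) = lift ord0 (lift ord0 c).
Proof. by rewrite tpermD. Qed.

(** Pairing s with its composite with the transposition, the sum of the two
    determinants has terms [M (s 0) 0, M (s 1) 1] * tail, and cross symmetry
    says precisely that this bracket does not change when s 0 and s 1 are
    exchanged. *)
Lemma cdet_swap01 r (M : 'M[S]_r.+2) : cross_symmetric M ->
  cdet (xcol ord0 (ord_one r) M) = - cdet M.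
Proof.
move=> Mc; apply/eqP; rewrite -addr_eq0; apply/eqP.
set t := tperm ord0 (ord_one r).
pose tl (s : 'S_r.+2) :=
  \prod_c M (s (lift ord0 (lift ord0 c))) (lift ord0 (lift ord0 c)).
pose G (s : 'S_r.+2) :=
  [< M (s ord0) ord0, M (s (ord_one r)) (ord_one r) >] * tl s.
have tlE s : tl (t * s)%g = tl s.
  by apply: eq_bigr => c _; rewrite permM tperm01_tail.
have oE (s : 'S_r.+2) : (-1) ^+ (t * s)%g = - (-1) ^+ s :> int.
  by rewrite odd_permM odd_tperm /=; case: odd_perm; rewrite ?opprK.
rewrite -[RHS](@sum_sign_sym _ _ ord0 (ord_one r) G) // => [|s]; last first.
  by rewrite /G tlE !permM tpermL tpermR Mc.
rewrite {1}/cdet (reindex_inj (mulgI t)) /= -big_split /=.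
apply: eq_bigr => s _.
rewrite oE !prod_perm01 -/(ord_one r) !permM -/t !mxE -/t tpermL tpermR.
under eq_bigr do rewrite permM tperm01_tail !mxE -/t tperm01_tail.
by rewrite mulrNz addrC -mulrzBl -mulrBl.
Qed.

Lemma cross_symmetric_minor r (M : 'M[S]_r.+1) i :
  cross_symmetric M -> cross_symmetric (row' i (col' ord0 M)).
Proof. by move=> Mc a b c d cd; rewrite !mxE Mc // (inj_eq lift_inj). Qed.

Lemma cross_symmetric_col_perm r (s : 'S_r) (M : 'M[S]_r) :
  cross_symmetric M -> cross_symmetric (col_perm s M).
Proof. by move=> Mc a b c d cd; rewrite !mxE Mc // (inj_eq perm_inj). Qed.

(** Expansion along column 0 reduces to the first two columns. *)
Lemma cdet_swap_adjacent r (M : 'M[S]_r) (c d : 'I_r) :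
  cross_symmetric M -> d = c.+1 :> nat -> cdet (xcol c d M) = - cdet M.
Proof.
elim: r M c d => [|r IHr] M c d Mc; first by case: c.
case: (unliftP ord0 c) => [c' ->|->] {c} dc; last first.
  case: r M d Mc dc {IHr} => [|r] M d Mc dc.
    by case: d dc => -[|d] //=.
  have -> : d = ord_one r by apply: val_inj; rewrite /= dc.
  exact: cdet_swap01.
have {dc} [d' -> d'c'] : exists2 d', d = lift ord0 d' & d' = c'.+1 :> nat.
  case: (unliftP ord0 d) dc => [d' ->|->] //.
  by rewrite !lift0 => -[dc]; exists d'.
rewrite !cdet_expand_col0 -sumrN; apply: eq_bigr => i _.
rewrite mxE tpermD ?neq_lift 1?eq_sym ?neq_lift // -mulNrz -mulrN.
rewrite -(IHr _ _ _ (cross_symmetric_minor i Mc) d'c').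
congr (_ * _ *~ _); apply: eq_cdet => a b.
by rewrite !mxE -inj_tperm //; apply: lift_inj.
Qed.

(** The permutations for which the sign rule holds are closed under
    composition and contain the adjacent transpositions, hence every
    transposition: conjugating (c d-1) by (d-1 d) gives (c d). *)
Lemma cdet_col_perm r (s : 'S_r) (M : 'M[S]_r) :
  cross_symmetric M -> cdet (col_perm s M) = cdet M *~ (-1) ^+ s.
Proof.
pose antisym (s : 'S_r) := forall M : 'M[S]_r, cross_symmetric M ->
  cdet (col_perm s M) = cdet M *~ (-1) ^+ s.
have antisymM u v : antisym u -> antisym v -> antisym (u * v)%g.
  move=> hu hv N Nc; rewrite col_permM hu ?hv //.
    by rewrite odd_permM signr_addb mulrC mulrzA.
  exact: cross_symmetric_col_perm.
have antisym_adj (c d : 'I_r) : d = c.+1 :> nat -> antisym (tperm c d).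
  move=> dc N Nc; rewrite -/(xcol c d N) cdet_swap_adjacent // odd_tperm.
  by rewrite -val_eqE /= dc neq_ltn ltnSn mulrN1z.
have antisym_lt k (c d : 'I_r) : d = (c + k.+1)%N :> nat -> antisym (tperm c d).
  elim: k d => [|k IHk] d dE; first by apply: antisym_adj; rewrite dE addn1.
  have d'r : (c + k.+1 < r)%N.
    by apply: leq_trans (ltn_ord d); rewrite dE !addnS.
  pose d' := Ordinal d'r.
  have cd' : c != d' by rewrite -val_eqE /= neq_ltn addnS leq_addr.
  have dd' : antisym (tperm d' d) by apply: antisym_adj; rewrite dE /= addnS.
  have cd : c != d by rewrite -val_eqE /= dE neq_ltn addnS ltnS leq_addr.
  have <- : (tperm c d' ^ tperm d' d = tperm c d)%g.
    by rewrite tpermJ tpermL tpermD // eq_sym.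
  rewrite conjgE tpermV; apply: (antisymM) => //; apply: (antisymM) => //.
  exact: IHk.
have antisym_tperm c d : c != d -> antisym (tperm c d).
  case: (ltngtP c d) => [lt_cd|lt_dc|/val_inj->]; last by rewrite eqxx.
    by move=> _; apply: (antisym_lt (d - c.+1)%N); rewrite addnS -addSn subnKC.
  rewrite tpermC.
  by move=> _; apply: (antisym_lt (c - d.+1)%N); rewrite addnS -addSn subnKC.
move: M; rewrite -/(antisym s); have [ts -> {s}] := prod_tpermP s.
elim: ts => [|t ts IHts] /=.
  by move=> _ M Mc; rewrite big_nil odd_perm1 col_perm1.
case/andP=> tN tsN; rewrite big_cons; apply: antisymM; last exact: IHts.
exact: antisym_tperm.
Qed.

(** Antisymmetry alone would only give that twice the determinant is 0. Once
    the equal columns are moved to positions 0 and 1, terms cancel in pairs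
    because the two entries taken from them commute. *)
Lemma cdet_alternate r (M : 'M[S]_r) (c d : 'I_r) :
    cross_symmetric M -> c != d -> M^~ c =1 M^~ d ->
  (forall i k, [< M i c, M k c >] = 0) -> cdet M = 0.
Proof.
case: r M c d => [|[|r]] M c d Mc cd Mcd Mcc; first by case: c {cd Mcd Mcc}.
  by rewrite !ord1 eqxx in cd.
(* s sends 0 to c and 1 to d; x is the preimage of d under (0 c). *)
pose x := tperm ord0 c d.
have x0 : ord0 != x.
  by rewrite /x -(inj_eq (@perm_inj _ (tperm ord0 c))) tpermK tpermL.
pose s := (tperm (ord_one r) x * tperm ord0 c)%g.
have s0 : s ord0 = c by rewrite permM [tperm _ x _]tpermD ?tpermL // eq_sym.
have s1 : s (ord_one r) = d by rewrite permM tpermL /x tpermK.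
suff N0 : cdet (col_perm s M) = 0.
  move: (N0); rewrite cdet_col_perm // => /(congr1 (fun z => z *~ (-1) ^+ s)).
  by rewrite -mulrzA -signr_addb addbb mul0rz.
set N := col_perm s M.
pose G (s : 'S_r.+2) := \prod_c N (s c) c.
apply: (@sum_sign_sym _ _ ord0 (ord_one r) G) => // u; rewrite /G.
have NE i : N i (ord_one r) = N i ord0 by rewrite !mxE s0 s1 Mcd.
rewrite !prod_perm01 -/(ord_one r) !permM tpermL tpermR !NE.
have -> : N (u (ord_one r)) ord0 * N (u ord0) ord0
        = N (u ord0) ord0 * N (u (ord_one r)) ord0.
  by apply/eqP; rewrite -subr_eq0; apply/eqP; rewrite !mxE s0; apply: Mcc.
by congr (_ * _); apply: eq_bigr => k _; rewrite permM tperm01_tail.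
Qed.

(** * Moving an element through a determinant *)

(** Bracketing with b is a derivation. *)
Lemma prod_lie r (x : 'I_r -> S) (b : S) :
  (\prod_c x c) * b = b * (\prod_c x c) +
    \sum_k \prod_c (if c == k then [< x c, b >] else x c).
Proof.
elim: r x => [|r IHr] x; first by rewrite !big_ord0 mul1r mulr1 addr0.
rewrite big_ord_recl -mulrA IHr mulrDr [\sum_(k < r.+1) _]big_ord_recl.
rewrite [\prod_(c < r.+1) _]big_ord_recl eqxx.
have -> : \prod_(c < r) (if lift ord0 c == ord0 then [< x (lift ord0 c), b >]
      else x (lift ord0 c)) = \prod_(c < r) x (lift ord0 c).
  by apply: eq_bigr.
rewrite addrA; congr (_ + _).
  by rewrite /lie mulrBl !mulrA [RHS]addrC subrK.
rewrite mulr_sumr; apply: eq_bigr => k _; rewrite big_ord_recl.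
by rewrite (negPf (neq_lift _ _)).
Qed.

(** Used with z = -1 and z = 0: it both extracts a sign and shows that a
    product with a zero factor vanishes. *)
Lemma prod_scale_at r (k : 'I_r) (v : S) (y : 'I_r -> S) (z : int) :
  \prod_c (if c == k then v *~ z else y c)
  = (\prod_c (if c == k then v else y c)) *~ z.
Proof.
elim: r k y => [|r IHr] k y; first by case: k.
rewrite !big_ord_recl; case: (unliftP ord0 k) => [k' ->|->].
  rewrite (negPf (neq_lift _ _)) -mulrzAr; congr (_ * _).
  under eq_bigr do rewrite (inj_eq lift_inj).
  under [in RHS]eq_bigr do rewrite (inj_eq lift_inj).
  exact: (IHr k' (fun c => y (lift ord0 c))).
by rewrite eqxx mulrzAl.
Qed.

Definition setcol m n (k : 'I_n) (v : 'I_m -> S) (N : 'M[S]_(m, n)) :=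
  \matrix_(i, c) if c == k then v i else N i c.

Definition consmx m n (v : 'I_m -> S) (N : 'M[S]_(m, n)) : 'M[S]_(m, n.+1) :=
  \matrix_(i, c) oapp (N i) (v i) (unlift ord0 c).

Lemma consmx0 m n (v : 'I_m -> S) (N : 'M[S]_(m, n)) i :
  consmx v N i ord0 = v i.
Proof. by rewrite mxE unlift_none. Qed.

Lemma consmx_lift m n (v : 'I_m -> S) (N : 'M[S]_(m, n)) i c :
  consmx v N i (lift ord0 c) = N i c.
Proof. by rewrite mxE liftK. Qed.

(** If bracketing with b turns each column of N into a multiple of one fixed
    column v, the derivation rule for determinants reads as follows. *)
Lemma cdet_lie r (N : 'M[S]_r) (b : S) (v : 'I_r -> S) (z : 'I_r -> int) :
    (forall i k, [< N i k, b >] = v i *~ z k) ->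
  cdet N * b = b * cdet N + \sum_k cdet (setcol k v N) *~ z k.
Proof.
move=> Nb; rewrite mulr_suml mulr_sumr.
under [X in _ = _ + X]eq_bigr do rewrite mulrz_suml.
rewrite exchange_big -big_split /=; apply: eq_bigr => s _.
rewrite mulrzAl prod_lie mulrzDl mulrzAr; congr (_ + _).
rewrite mulrz_suml; apply: eq_bigr => k _.
rewrite mulrzAC; congr (_ *~ _).
transitivity (\prod_c (if c == k then v (s k) *~ z k else N (s c) c)).
  by apply: eq_bigr => c _; case: eqP => [->|]; rewrite ?Nb.
rewrite prod_scale_at; congr (_ *~ _); apply: eq_bigr => c _.
by rewrite mxE; case: eqP => [->|].
Qed.

Lemma cdet_consmx r (v : 'I_r.+1 -> S) (N : 'M[S]_(r.+1, r)) :
  cdet (consmx v N) = \sum_i (v i * cdet (row' i N)) *~ (-1) ^+ i.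
Proof.
rewrite cdet_expand_col0; apply: eq_bigr => i _; rewrite consmx0.
by congr (_ * _ *~ _); apply: eq_cdet => a c; rewrite !mxE liftK.
Qed.

Lemma lieN (x y : S) : [< x, y >] = - [< y, x >].
Proof. by rewrite /lie opprB. Qed.

(** The Jacobi identity when x and y commute. *)
Lemma lie_lieC (x y b : S) :
  [< x, y >] = 0 -> [< x, [< y, b >] >] = [< y, [< x, b >] >].
Proof.
move/eqP; rewrite subr_eq0 => /eqP xy.
rewrite /lie !mulrBr !mulrBl !mulrA xy -(mulrA b y x) -xy mulrA !opprB.
by rewrite addrACA [- _ - _]addrC addrACA.
Qed.

(** A column with the bracket symmetry of the hypothesis can be adjoined to
    columns of A without losing antisymmetry; its own entries need not
    commute. *)
Lemma pseudo_comm_consmx r n (A : 'M[S]_(r.+1, n)) (g : 'I_r -> 'I_n)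
    (u : 'I_r.+1 -> S) :
    row_pseudo_comm A -> (forall i k j, [< A i j, u k >] = [< A k j, u i >]) ->
  cross_symmetric (consmx u (colsub g A)).
Proof.
move=> [Ac _] Au i k c d.
case: (unliftP ord0 c) => [c' ->|->]; case: (unliftP ord0 d) => [d' ->|->];
  rewrite ?eqxx // ?consmx0 ?consmx_lift !mxE => _.
- exact: Ac.
- exact: Au.
- by rewrite lieN Au -lieN.
Qed.

(** The heart of the proof: b is moved to the left until it follows the
    entries of column 0, at the cost of r copies of the column u, one for each
    column crossed. *)
Lemma sum_cdet_consmx_mulr r n (A : 'M[S]_(r.+1, n)) (g : 'I_r -> 'I_n)
    (b : 'I_n -> S) (u : 'I_r.+1 -> S) :
    row_pseudo_comm A -> (forall i k j, [< A i j, u k >] = [< A k j, u i >]) ->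
    (forall i j l, [< A i j, b l >] = - (if j == l then u i else 0)) ->
  \sum_l cdet (consmx (A^~ l) (colsub g A)) * b l
  = \sum_i ((\sum_l A i l * b l + u i *+ r) * cdet (row' i (colsub g A)))
      *~ (-1) ^+ i.
Proof.
move=> Ac Au Ab; set N := colsub g A.
(* The bracket of column k of N with b l is u scaled by z l k. *)
pose z l k : int := - (g k == l)%:R.
have NbE i l : cdet (row' i N) * b l = b l * cdet (row' i N)
    + \sum_k cdet (row' i (setcol k u N)) *~ z l k.
  rewrite (@cdet_lie _ _ _ (fun a => u (lift i a)) (z l)) => [|a k].
    congr (_ + _); apply: eq_bigr => k _; congr (_ *~ _).
    by apply: eq_cdet => a c; rewrite !mxE.
  by rewrite !mxE Ab /z; case: eqP => _; rewrite ?mulrN1z // oppr0 mulr0z.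
(* The correction of column k leaves A^~ (g k) in front and u in position k;
   exchanging them restores N at the cost of a sign. *)
have colE k : \sum_i (A i (g k) * cdet (row' i (setcol k u N))) *~ (-1) ^+ i
    = - cdet (consmx u N).
  have cs := pseudo_comm_consmx g Ac Au.
  have k0 : ord0 != lift ord0 k by apply: neq_lift.
  rewrite -(cdet_consmx (A^~ (g k))).
  have -> : - cdet (consmx u N) = cdet (xcol ord0 (lift ord0 k) (consmx u N)).
    by rewrite cdet_col_perm // odd_tperm k0 mulrN1z.
  apply: eq_cdet => a c; rewrite mxE [RHS]mxE.
  case: (unliftP ord0 c) => [c' ->|->] /=.
    rewrite mxE; case: eqP => [->|/eqP c'k]; first by rewrite tpermR consmx0.
    rewrite tpermD ?consmx_lift ?neq_lift //.
    by rewrite (inj_eq lift_inj) eq_sym.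
  by rewrite tpermL consmx_lift mxE.
have -> : \sum_l cdet (consmx (A^~ l) N) * b l
    = \sum_i ((\sum_l A i l * b l) * cdet (row' i N)) *~ (-1) ^+ i
    - \sum_k \sum_i (A i (g k) * cdet (row' i (setcol k u N))) *~ (-1) ^+ i.
  rewrite [X in _ - X]exchange_big /= -sumrB.
  under eq_bigr do rewrite cdet_consmx mulr_suml.
  rewrite exchange_big; apply: eq_bigr => i _ /=.
  rewrite -mulrz_suml -mulrzBl.
  under eq_bigr do rewrite mulrzAl -mulrA NbE.
  rewrite -mulrz_suml; congr (_ *~ _).
  under [LHS]eq_bigr do rewrite mulrDr mulrA [_ * (\sum_(k < r) _)]mulr_sumr.
  rewrite big_split /= mulr_suml; congr (_ + _).
  rewrite exchange_big -sumrN; apply: eq_bigr => k _ /=.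
  rewrite (bigD1 (g k)) //= big1 ?addr0 => [|l lk].
    by rewrite /z eqxx mulrzAr mulrN1z.
  by rewrite /z eq_sym (negPf lk) oppr0 mulr0z mulr0.
under [X in _ - X]eq_bigr do rewrite colE.
rewrite sumr_const card_ord mulNrn opprK cdet_consmx -sumrMnl -big_split /=.
apply: eq_bigr => i _; rewrite mulrDl mulrzDl; congr (_ + _).
by rewrite mulrnAl !pmulrn mulrzAC.
Qed.

(** * The Cauchy-Binet identity over a unital ring *)

(** Each structure element h k s is minus the bracket of A k j with B s j, for
    any j, and the entries A i j and A k j of one column commute, so the
    Jacobi identity applies. *)
Lemma lie_structure_sym r m n (A : 'M[S]_(m, n)) (B : 'M[S]_(r, n))
    (h : 'M[S]_(m, r)) :
    row_pseudo_comm A ->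
    (forall i k j l, [< A i j, B k l >] = - (if j == l then h i k else 0)) ->
  forall i k j s, [< A i j, h k s >] = [< A k j, h i s >].
Proof.
move=> [_ Ac] AB i k j s.
have hE a : h a s = - [< A a j, B s j >] by rewrite AB eqxx opprK.
have lieNr x y : [< x, - y >] = - [< x, y >] :> S.
  by rewrite /lie mulrN mulNr -opprD.
by rewrite !hE !lieNr; congr (- _); apply: lie_lieC.
Qed.

Definition fcons n r (l : 'I_n) (g : {ffun 'I_r -> 'I_n}) :
    {ffun 'I_r.+1 -> 'I_n} :=
  [ffun c => oapp g l (unlift ord0 c)].

Lemma sum_fcons n r (F : {ffun 'I_r.+1 -> 'I_n} -> S) :
  \sum_f F f = \sum_(g : {ffun 'I_r -> 'I_n}) \sum_l F (fcons l g).
Proof.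
rewrite pair_big /= (reindex (fun p => fcons p.2 p.1)) //=.
exists (fun f : {ffun 'I_r.+1 -> 'I_n} => ([ffun c => f (lift ord0 c)], f ord0)).
  move=> [g l] _; congr (_, _); last by rewrite ffunE unlift_none.
  by apply/ffunP => c; rewrite !ffunE liftK.
by move=> f _; apply/ffunP => c; rewrite ffunE; case: unliftP => [c'|] -> //=;
  rewrite ffunE.
Qed.

(** Induction on r: the columns f 1, f 2, ... and the factors of B that go
    with them stay untouched while the first column is processed, and for each
    choice i of the row used in it they form the same sum with row i of A and
    row 0 of B removed. The weight r - j.+1 of column j is also its weight in
    the smaller matrix. *)
Theorem sum_cdet_colsub r n (A B : 'M[S]_(r, n)) (h : 'M[S]_r) :
    row_pseudo_comm A ->
    (forall i k j l, [< A i j, B k l >] = - (if j == l then h i k else 0)) ->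
  \sum_(f : {ffun 'I_r -> 'I_n}) cdet (colsub f A) * \prod_c B c (f c)
  = cdet (\matrix_(i, j) (\sum_l A i l * B j l + h i j *+ (r - j.+1))).
Proof.
elim: r A B h => [|r IHr] A B h Ac AB.
  rewrite (big_pred1 (ffun0 (card_ord 0))) => [|f].
    by rewrite big_ord0 mulr1; apply: eq_cdet => -[].
  by apply/esym/eqP/ffunP => -[].
have hs := lie_structure_sym Ac AB.
rewrite sum_fcons.
pose X i := \sum_l A i l * B ord0 l + h i ord0 *+ r.
transitivity (\sum_(g : {ffun 'I_r -> 'I_n}) \sum_i
    (X i * (cdet (row' i (colsub g A)) * \prod_c B (lift ord0 c) (g c)))
      *~ (-1) ^+ i).
  apply: eq_bigr => g _.
  transitivity ((\sum_l cdet (consmx (A^~ l) (colsub g A)) * B ord0 l)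
      * \prod_c B (lift ord0 c) (g c)).
    rewrite mulr_suml; apply: eq_bigr => l _.
    rewrite big_ord_recl ffunE unlift_none /= mulrA; congr (_ * _ * _).
      apply: eq_cdet => i c; rewrite !mxE ffunE.
      by case: (unliftP ord0 c) => [c' _|_]; rewrite //= mxE.
    by apply: eq_bigr => c _; rewrite ffunE liftK.
  rewrite (@sum_cdet_consmx_mulr _ _ _ _ _ (h^~ ord0)) // mulr_suml.
  by apply: eq_bigr => i _; rewrite mulrzAl mulrA.
rewrite exchange_big [RHS]cdet_expand_col0; apply: eq_bigr => i _ /=.
rewrite -mulrz_suml -mulr_sumr !mxE subSS subn0; congr (_ * _ *~ _).
pose A' : 'M[S]_(r, n) := row' i A; pose B' : 'M[S]_(r, n) := row' ord0 B.
pose h' : 'M[S]_r := row' i (col' ord0 h).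
have A'c : row_pseudo_comm A'.
  by split=> [a b c d|a b c]; rewrite !mxE; [apply: Ac.1|apply: Ac.2].
have A'B' a b c d : [< A' a c, B' b d >] = - (if c == d then h' a b else 0).
  by rewrite !mxE AB.
transitivity (\sum_(g : {ffun 'I_r -> 'I_n})
    cdet (colsub g A') * \prod_c B' c (g c)).
  apply: eq_bigr => g _; congr (_ * _); last by apply: eq_bigr => c _; rewrite mxE.
  by apply: eq_cdet => a c; rewrite !mxE.
rewrite (IHr _ _ _ A'c A'B'); apply: eq_cdet => a c; rewrite !mxE subSS.
by congr (_ + _); apply: eq_bigr => l _; rewrite !mxE.
Qed.

(** The map (L, s) |-> elt L \o s is a bijection onto the injective maps, and
    det A_f vanishes for the other maps by alternation. *)
Lemma sum_ksubset_cdet r n (A B : 'M[S]_(r, n)) :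
    row_pseudo_comm A ->
  \sum_(L : ksubset n r) cdet (colsub (elt L) A) * cdet (colsub (elt L) B)^T
  = \sum_(f : {ffun 'I_r -> 'I_n}) cdet (colsub f A) * \prod_c B c (f c).
Proof.
move=> [Ac Acc].
have sub_cs (f : 'I_r -> 'I_n) : cross_symmetric (colsub f A).
  by move=> i k c d _; rewrite !mxE Ac.
have elt_inj (L : ksubset n r) : injective (elt L).
  move=> a b E; case: (ltngtP a b) => [ab|ba|/val_inj//].
    by have := elt_lt L ab; rewrite E ltnn.
  by have := elt_lt L ba; rewrite E ltnn.
pose phi (p : ksubset n r * 'S_r) : {ffun 'I_r -> 'I_n} :=
  [ffun c => elt p.1 (p.2 c)].
have phi_inj : injective phi.
  move=> [L s] [L' s'] E.
  have im_phi p : [set phi p c | c : 'I_r] = val p.1.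
    rewrite -elt_codom; apply/setP => x.
    apply/imsetP/imsetP => -[c _ ->]; first by exists (p.2 c); rewrite // ffunE.
    by exists (p.2^-1%g c); rewrite // ffunE permKV.
  have LL' : L = L'.
    by apply: val_inj; rewrite -(im_phi (L, s)) -(im_phi (L', s')) E.
  rewrite LL' in E *; congr (_, _); apply/permP => c; apply: (elt_inj L').
  by have := congr1 (fun f : {ffun _} => f c) E; rewrite !ffunE.
have phi_surj (f : {ffun 'I_r -> 'I_n}) : injective f -> exists p, f = phi p.
  move=> f_inj.
  have fL : #|[set f c | c : 'I_r]| == r by rewrite card_imset // card_ord.
  pose L : ksubset n r := exist (fun X : {set 'I_n} => #|X| == r) _ fL.
  have [s sE] : exists s : 'I_r -> 'I_r, forall c, f c = elt L (s c).
    apply: (@fin_all_exists _ _ (fun c a => f c = elt L a)) => c.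
    have : f c \in [set elt L a | a : 'I_r] by rewrite elt_codom /= imset_f.
    by case/imsetP => a _ fc; exists a.
  have s_inj : injective s.
    by move=> c d scd; apply: f_inj; rewrite !sE scd.
  by exists (L, perm s_inj); apply/ffunP => c; rewrite ffunE sE /= permE.
rewrite [RHS](bigID (mem (phi @: setT))) /= [X in _ + X]big1 ?addr0 => [|f fN].
  rewrite big_imset /= => [|p q _ _ /phi_inj//].
  under [RHS]eq_bigl do rewrite in_setT.
  rewrite -(pair_big xpredT xpredT (fun L s => cdet (colsub (phi (L, s)) A)
    * \prod_c B c (phi (L, s) c))) /=.
  apply: eq_bigr => L _; rewrite mulr_sumr; apply: eq_bigr => s _.
  have -> : cdet (colsub (phi (L, s)) A) = cdet (colsub (elt L) A) *~ (-1) ^+ s.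
    rewrite -cdet_col_perm //; apply: eq_cdet => i c.
    by rewrite !mxE ffunE.
  rewrite mulrzAr mulrzAl; congr (_ * _ *~ _).
  by apply: eq_bigr => c _; rewrite !mxE ffunE.
case: (boolP (injectiveb f)) => [/injectiveP/phi_surj[p fE]|/injectivePn].
  by case/negP: fN; rewrite fE; apply: imset_f.
case=> c [d cd fcd].
rewrite (@cdet_alternate _ _ c d) ?mul0r // => [i|i k]; rewrite !mxE ?fcd //.
Qed.

Theorem col_cauchy_binet r n (A B : 'M[S]_(r, n)) (h : 'M[S]_r) :
    row_pseudo_comm A ->
    (forall i k j l, [< A i j, B k l >] = - (if j == l then h i k else 0)) ->
  \sum_(L : ksubset n r) cdet (colsub (elt L) A) * cdet (colsub (elt L) B)^T
  = cdet (\matrix_(i, j) (\sum_l A i l * B j l + h i j *+ (r - j.+1))).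
Proof. by move=> Ac AB; rewrite sum_ksubset_cdet // (sum_cdet_colsub Ac AB). Qed.

End Unital.

(** * Row determinants by reversing products *)

Lemma prod_converse (S : pzRingType) r (x : 'I_r -> S) :
  (\prod_c (x c : S^c) : S^c) = \prod_c x (rev_ord c).
Proof.
elim: r x => [|r IHr] x; first by rewrite !big_ord0.
rewrite big_ord_recl big_ord_recr /=.
have -> : rev_ord ord_max = ord0 :> 'I_r.+1 by apply: val_inj; rewrite /= subnn.
rewrite (IHr (fun c => x (lift ord0 c))); congr (_ * _).
apply: eq_bigr => c _; congr (x _); apply: val_inj => /=.
by rewrite /bump /= subSS add1n subnSK.
Qed.

Definition rev_perm r : 'S_r := perm (@rev_ord_inj r).

(** Reversing the order of the columns compensates the reversal of products,
    so that the factors of the row determinant come back in order. *)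
Lemma cdet_converse (S : pzRingType) r (M : 'M[S]_r) :
  @cdet S^c r (\matrix_(i, c) M (rev_ord c) i) = rowdet M *~ (-1) ^+ rev_perm r.
Proof.
rewrite /rowdet (reindex_inj (mulgI (rev_perm r))) mulrz_suml.
apply: eq_bigr => s _.
rewrite odd_permM signr_addb -[RHS]mulrzA mulrAC -signr_addb addbb mul1r.
congr (_ *~ _); rewrite prod_converse; apply: eq_bigr => c _.
by rewrite mxE rev_ordK permM permE.
Qed.

(** The column version over the converse ring, with B in the role of A and the
    rows of A, in reverse order, in the role of B: reversal turns the weight
    r - j.+1 into j. The sign of the reversal occurs once on each side: in the
    left-hand minors it comes from those of A, while for those of B it is
    cancelled by column antisymmetry. *)
Theorem row_cauchy_binet (S : pzRingType) r n (A B : 'M[S]_(r, n))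
    (h : 'M[S]_r) :
    row_pseudo_comm B ->
    (forall i k j l, [< A i j, B k l >] = - (if j == l then h i k else 0)) ->
  \sum_(L : ksubset n r) rowdet (colsub (elt L) A) * rowdet (colsub (elt L) B)^T
  = rowdet (\matrix_(i, j) (\sum_l A i l * B j l + h i j *+ i)).
Proof.
move=> [Bc Bcc] AB.
have lie_conv (x y : S) : @lie S^c x y = - [< x, y >] by rewrite /lie opprB.
have Bcc' : @row_pseudo_comm S^c r n B.
  by split=> *; rewrite !lie_conv ?Bcc ?oppr0 // Bc.
pose A' : 'M[S^c]_(r, n) := \matrix_(i, l) A (rev_ord i) l.
pose h' : 'M[S^c]_r := \matrix_(j, i) h (rev_ord i) j.
have BA' i k j l : @lie S^c (B i j) (A' k l) = - (if j == l then h' i k else 0).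
  by rewrite !mxE lie_conv /= lieN opprK AB eq_sym.
pose e := (-1) ^+ rev_perm r : int.
have eK (x : S) : x *~ e *~ e = x by rewrite -mulrzA -signr_addb addbb.
have BE (L : ksubset n r) :
    @cdet S^c r (colsub (elt L) B) = rowdet (colsub (elt L) B)^T.
  rewrite -[RHS]eK -cdet_converse -[LHS]eK; congr (_ *~ _).
  have cs : @cross_symmetric S^c r r (colsub (elt L) B).
    by move=> i k c d _; rewrite !mxE Bcc'.1.
  apply: etrans (esym (cdet_col_perm (rev_perm r) cs)) _.
  by apply: eq_cdet => i c; rewrite !mxE permE.
have AE (L : ksubset n r) :
    @cdet S^c r (colsub (elt L) A')^T = rowdet (colsub (elt L) A) *~ e.
  by rewrite -cdet_converse; apply: eq_cdet => i c; rewrite !mxE.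
rewrite -[RHS]eK -cdet_converse.
rewrite (@eq_cdet S^c r _ (\matrix_(i, j)
    (\sum_l (B i l : S^c) * A' j l + h' i j *+ (r - j.+1)))) => [|i c].
  rewrite -(col_cauchy_binet Bcc' BA') mulrz_suml; apply: eq_bigr => L _.
  by rewrite BE AE -[RHS]/((rowdet _ *~ e * rowdet _) *~ e) mulrzAl eK.
by rewrite !mxE; congr (_ + _); apply: eq_bigr => l _; rewrite mxE.
Qed.

(** * The unitization of a ring without unit *)

Lemma rmulzl (R : rngType) (x y : R) (a : int) : (x *~ a) ** y = (x ** y) *~ a.
Proof.
pose f (x : R) := x ** y.
have fB : zmod_morphism f.
  move=> u v; apply: (addIr (v ** y)).
  by rewrite /f -rmulDl subrK subrK.
pose fM := GRing.isZmodMorphism.Build R R f fB.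
pose F : {additive R -> R} := HB.pack f fM.
exact: (raddfMz F).
Qed.

Lemma rmulzr (R : rngType) (x y : R) (a : int) : x ** (y *~ a) = (x ** y) *~ a.
Proof.
pose f (y : R) := x ** y.
have fB : zmod_morphism f.
  move=> u v; apply: (addIr (x ** v)).
  by rewrite /f -rmulDr subrK subrK.
pose fM := GRing.isZmodMorphism.Build R R f fB.
pose F : {additive R -> R} := HB.pack f fM.
exact: (raddfMz F).
Qed.

Lemma rmul0l (R : rngType) (y : R) : 0 ** y = 0.
Proof. by rewrite -(mulr0z 0) rmulzl mulr0z. Qed.

Lemma rmul0r (R : rngType) (x : R) : x ** 0 = 0.
Proof. by rewrite -(mulr0z 0) rmulzr mulr0z. Qed.

(** The pair (a, x) stands for the formal sum a * 1 + x. *)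
Definition unitization (R : rngType) : Type := (int * R)%type.

HB.instance Definition _ (R : rngType) := GRing.Zmodule.on (unitization R).

Section Unitization.
Variable R : rngType.

Definition umul (p q : unitization R) : unitization R :=
  (p.1 * q.1, p.2 ** q.2 + p.2 *~ q.1 + q.2 *~ p.1).

Lemma umulA : associative umul.
Proof.
move=> [a x] [b y] [c z]; rewrite /umul /=; congr (_, _); first exact: mulrA.
rewrite !rmulDl !rmulDr !rmulzl !rmulzr rmulA !mulrzDl -!mulrzA.
rewrite ![b * _]mulrC ![c * _]mulrC.
by rewrite [LHS](AC (4*3) ((1*3*5)*(2*4*6)*7)).
Qed.

Lemma umul1r : left_id ((1, 0) : unitization R) umul.
Proof.
by move=> [b y]; rewrite /umul /= mul1r rmul0l mul0rz !add0r.
Qed.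

Lemma umulr1 : right_id ((1, 0) : unitization R) umul.
Proof.
by move=> [b y]; rewrite /umul /= mulr1 rmul0r mul0rz add0r addr0.
Qed.

Lemma umulDl : left_distributive umul +%R.
Proof.
move=> [a x] [b y] [c z]; congr (_, _); first exact: mulrDl.
rewrite /= rmulDl mulrzDl mulrzDr.
by rewrite (addrACA (x ** z)) (addrACA (x ** z + _)).
Qed.

Lemma umulDr : right_distributive umul +%R.
Proof.
move=> [a x] [b y] [c z]; congr (_, _); first exact: mulrDr.
rewrite /= rmulDr mulrzDl mulrzDr.
by rewrite (addrACA (x ** y)) (addrACA (x ** y + _)).
Qed.

HB.instance Definition _ := GRing.Zmodule_isPzRing.Build (unitization R)
  umulA umul1r umulr1 umulDl umulDr.

Definition emb (x : R) : unitization R := (0, x).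

Lemma emb_is_zmod_morphism : zmod_morphism emb.
Proof. by move=> x y; congr (_, _); rewrite /= subrr. Qed.

HB.instance Definition _ :=
  GRing.isZmodMorphism.Build R (unitization R) emb emb_is_zmod_morphism.

Lemma embM x y : emb (x ** y) = emb x * emb y.
Proof. by congr (_, _); rewrite /= !mulr0z !addr0. Qed.

Lemma emb_inj : injective emb.
Proof. by move=> x y []. Qed.

(** The value 0 chosen for the empty product is not the unit, hence the
    condition on s. *)
Lemma emb_rprod s : s != [::] -> emb (rprod s) = \prod_(x <- s) emb x.
Proof.
elim: s => // x s IHs _; have [->|sN0] := eqVneq s [::].
  by rewrite big_seq1.
by rewrite rprod_cons // embM IHs // big_cons.
Qed.

Lemma emb_lie x y : emb (rcomm x y) = [< emb x, emb y >].
Proof. by rewrite /rcomm emb_is_zmod_morphism !embM. Qed.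

Lemma emb_prod_enum r (f : 'I_r -> R) : (0 < r)%N ->
  emb (rprod [seq f a | a <- enum 'I_r]) = \prod_a emb (f a).
Proof.
move=> r0; rewrite emb_rprod ?big_map ?big_enum //.
by rewrite -size_eq0 size_map size_enum_ord -lt0n.
Qed.

Lemma emb_col_det r (M : 'M[R]_r) : (0 < r)%N ->
  emb (col_det M) = cdet (map_mx emb M).
Proof.
move=> r0; rewrite raddf_sum /=; apply: eq_bigr => s _; rewrite raddfMz /=.
by rewrite emb_prod_enum //; congr (_ *~ _); apply: eq_bigr => a _; rewrite mxE.
Qed.

Lemma emb_row_det r (M : 'M[R]_r) : (0 < r)%N ->
  emb (row_det M) = rowdet (map_mx emb M).
Proof.
move=> r0; rewrite raddf_sum /=; apply: eq_bigr => s _; rewrite raddfMz /=.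
by rewrite emb_prod_enum //; congr (_ *~ _); apply: eq_bigr => a _; rewrite mxE.
Qed.

End Unitization.

(** * Minors over a ring without unit *)

Theorem proposition1 (R : rngType) (m n : nat) (A B : 'M[R]_(m, n))
    (h : 'M[R]_m)
    (hAB : forall (i k : 'I_m) (j l : 'I_n),
       rcomm (A i j) (B k l) = - (if j == l then h i k else 0))
    (r : nat) (hr : (1 <= r <= m)%N) (I J : ksubset m r) :
  [/\ (row_pseudo_commutative A ->
       \sum_(L : ksubset n r)
          col_det (minormx A I L) ** col_det (minormx B^T L J)
       = col_det (minormx (rmulmx A B^T) I J + Q_col h I J)),
      (row_pseudo_commutative B ->
       \sum_(L : ksubset n r)
          row_det (minormx A I L) ** row_det (minormx B^T L J)
       = row_det (minormx (rmulmx A B^T) I J + Q_row h I J))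
    & ((forall (i k : 'I_m) (j l : 'I_n), i != k -> rcomm (A i j) (A k l) = 0) ->
       (forall (i k : 'I_m) (j l : 'I_n), i != k -> rcomm (B i j) (B k l) = 0) ->
       \sum_(L : ksubset n r)
          rdet (minormx A I L) ** rdet (minormx B^T L J)
       = col_det (minormx (rmulmx A B^T) I J + Q_col h I J)
       /\ col_det (minormx (rmulmx A B^T) I J + Q_col h I J)
       = row_det (minormx (rmulmx A B^T) I J + Q_row h I J))].
Proof.
have r0 : (0 < r)%N by case/andP: hr.
pose eA : 'M[unitization R]_(r, n) := \matrix_(a, l) emb (A (elt I a) l).
pose eB : 'M[unitization R]_(r, n) := \matrix_(b, l) emb (B (elt J b) l).
pose eh : 'M[unitization R]_r := \matrix_(a, b) emb (h (elt I a) (elt J b)).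
have eAB i k j l : [< eA i j, eB k l >] = - (if j == l then eh i k else 0).
  by rewrite !mxE -emb_lie hAB raddfN; case: eqP; rewrite ?raddf0.
have minorA L : map_mx (@emb R) (minormx A I L) = colsub (elt L) eA.
  by apply/matrixP => a b; rewrite !mxE.
have minorB L : map_mx (@emb R) (minormx B^T L J) = (colsub (elt L) eB)^T.
  by apply/matrixP => a b; rewrite !mxE.
have productE (a b : 'I_r) : \sum_l eA a l * eB b l
    = emb (minormx (rmulmx A B^T) I J a b).
  rewrite !mxE raddf_sum /=; apply: eq_bigr => l _.
  by rewrite !mxE embM.
have sumE (M N : 'M[R]_r) a b : (M + N) a b = M a b + N a b by rewrite mxE.
have pseudo_emb (M : 'M[R]_(m, n)) (K : ksubset m r) :
    row_pseudo_commutative M ->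
    row_pseudo_comm (\matrix_(a, l) emb (M (elt K a) l) : 'M_(r, n)).
  move=> [Mc Mcc]; split=> *; rewrite !mxE -!emb_lie ?Mcc ?raddf0 //.
  by rewrite Mc.
have colCB : row_pseudo_commutative A -> \sum_(L : ksubset n r)
      col_det (minormx A I L) ** col_det (minormx B^T L J)
    = col_det (minormx (rmulmx A B^T) I J + Q_col h I J).
  move=> Ac; apply: emb_inj; rewrite emb_col_det // raddf_sum.
  have := col_cauchy_binet (pseudo_emb _ I Ac) eAB; rewrite -/eA.
  under eq_bigr do rewrite -minorA -minorB -!emb_col_det // -embM.
  move=> ->; congr cdet; apply/matrixP => a b.
  rewrite mxE productE [RHS]mxE sumE.
  by rewrite raddfD /=; congr (_ + _); rewrite !mxE raddfMn.
have rowCB : row_pseudo_commutative B -> \sum_(L : ksubset n r)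
      row_det (minormx A I L) ** row_det (minormx B^T L J)
    = row_det (minormx (rmulmx A B^T) I J + Q_row h I J).
  move=> Bc; apply: emb_inj; rewrite emb_row_det // raddf_sum.
  have := row_cauchy_binet (pseudo_emb _ J Bc) eAB; rewrite -/eB.
  under eq_bigr do rewrite -minorA -minorB -!emb_row_det // -embM.
  move=> ->; congr rowdet; apply/matrixP => a b.
  rewrite mxE productE [RHS]mxE sumE.
  by rewrite raddfD /=; congr (_ + _); rewrite !mxE raddfMn.
split=> // Ac Bc.
have pseudo_of_comm (M : 'M[R]_(m, n)) :
    (forall i k j l, i != k -> rcomm (M i j) (M k l) = 0) ->
    row_pseudo_commutative M.
  move=> Mc; split=> [i k j l|i k j]; have [->|ik] := eqVneq i k => //.
  - by rewrite !Mc // eq_sym.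
  - exact: subrr.
  - exact: Mc.
have elt_neq K (a b : 'I_r) : a != b -> elt (K : ksubset m r) a != elt K b.
  by rewrite /elt (inj_eq enum_val_inj) (inj_eq (@cast_ord_inj _ _ _)).
split; first exact: colCB (pseudo_of_comm _ Ac).
rewrite -colCB -?rowCB; try exact: pseudo_of_comm.
apply: eq_bigr => L _; rewrite -!rdet_row_det //.
  by move=> i j k l ik jl; rewrite !mxE Bc // elt_neq.
by move=> i j k l ik jl; rewrite !mxE Ac // elt_neq.
Qed.
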